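(* Let $X$ and $Y$ be Banach spaces, let $\mu_0$ be a Borel probability measure on $X$, and let $\Phi : X\times Y \to \mathbb{R}$ satisfy the following conditions. (i) There is a positive non-decreasing function $f_1:\mathbb{R}_+\to[1,\infty)$ such that for every $r>0$ there is a constant $M(r)\in\mathbb{R}$ with $\Phi(u;y)\ge M(r)-\log\left(f_1(\|u\|_X)\right)$ for all $u\in X$ and all $y\in B_Y(r)$. (ii) For every $r>0$ there is a constant $K(r)>0$ with $\Phi(u;y)\le K(r)$ for all $u\in B_X(r)$ and all $y\in B_Y(r)$. (iii) For every $r>0$ there is a constant $L(r)>0$ with $|\Phi(u_1;y)-\Phi(u_2;y)|\le L(r)\|u_1-u_2\|_X$ for all $u_1,u_2\in B_X(r)$ and all $y\in B_Y(r)$. If $f_1(\|\cdot\|_X)\in L^1(X,\mu_0)$, then (for every $y\in Y$) the posterior $\mu^y$ given by Bayes' rule $$\frac{d\mu^y}{d\mu_0}(u)=\frac{1}{Z(y)}\exp(-\Phi(u;y)),\qquad Z(y)=\int_X\exp(-\Phi(u;y))\,d\mu_0(u),$$ is a well-defined Borel probability measure on $X$. If $\mu_0$ is Radon, then so is $\mu^y$.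
   Context: $\mathbb{R}_+=[0,\infty)$. $B_X(r)$ and $B_Y(r)$ denote the open balls of radius $r$ centered at the origin in $X$ and $Y$. $X$ is not assumed separable. A Radon probability measure is an inner regular probability measure on the Borel sets. All probability measures considered are complete (every subset of a null set has measure zero). *)

(* Defs.v *)
From HB Require Import structures.
From mathcomp Require Import all_boot all_order all_algebra.
From mathcomp Require Import all_classical all_reals all_analysis.
From mathcomp Require Import measurable_realfun.

Set Implicit Arguments.
Unset Strict Implicit.
Unset Printing Implicit Defensive.

Import Order.TTheory GRing.Theory Num.Theory.
Import numFieldNormedType.Exports.

Local Open Scope classical_set_scope.
Local Open Scope ring_scope.
Local Open Scope ereal_scope.

Definition borel (X : topologicalType) : set (set X) := <<s @open X >>.
Arguments borel X : clear implicits.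

(* Probability measures are complete, so a Borel probability measure is defined
   on the completion of the Borel sigma-algebra with respect to itself. That
   sigma-algebra depends on the measure; it is represented as <<s G >>, where
   G may be any family of sets and hence <<s G >> any sigma-algebra on X. It
   contains the Borel sets and all subsets of null sets, and the last clause
   says that it is not larger than the completion: requiring A to be a Borel
   set up to a null set of <<s G >> would not exclude proper extensions, hence
   the Borel bounds B and C. *)
Definition complete_borel (R : realType) (X : normedModType R)
    (G : set (set X)) (mu : probability (g_sigma_algebraType G) R) : Prop :=
  [/\ borel X `<=` <<s G >>,
      measure_is_complete mu &
      forall A : set X, <<s G >> A ->
        exists B C : set X,
          [/\ borel X B, borel X C, B `<=` A, A `<=` C & mu (C `\` B) = 0]].

(* Inner regularity with respect to compact sets. *)
Definition radon (R : realType) (X : normedModType R)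
    (G : set (set X)) (mu : probability (g_sigma_algebraType G) R) : Prop :=
  forall B : set X, borel X B ->
    mu B = ereal_sup [set mu K | K in [set K : set X | compact K /\ K `<=` B]].

Section posterior.
Context (R : realType) (X Y : normedModType R) (G : set (set X)).
Variables (mu0 : probability (g_sigma_algebraType G) R) (Phi : X -> Y -> R).

Definition likelihood (y : Y) (u : g_sigma_algebraType G) : \bar R :=
  (expR (- Phi u y)%R)%:E.

Definition evidence (y : Y) : \bar R := \int[mu0]_u likelihood y u.

(* d mu / d mu0 = exp (- Phi (.; y)) / Z(y). The value [fine] takes at infinity
   is immaterial: it is only used when 0 < Z(y) < +oo. *)
Definition is_posterior (y : Y)
    (mu : probability (g_sigma_algebraType G) R) : Prop :=
  forall A : set X, <<s G >> A ->
    mu A = \int[mu0]_(u in A) (expR (- Phi u y) / fine (evidence y))%R%:E.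

(* The density in Bayes' rule is meaningful: the likelihood is measurable and
   the normalizing constant is neither 0 nor infinite. *)
Definition bayes_well_defined (y : Y) : Prop :=
  measurable_fun setT (likelihood y) /\ 0 < evidence y < +oo.

End posterior.

(* Main.v *)
Require Import Defs.
From HB Require Import structures.
From mathcomp Require Import all_boot all_order all_algebra.
From mathcomp Require Import all_classical all_reals all_analysis.
From mathcomp Require Import measurable_realfun.

Set Implicit Arguments.
Unset Strict Implicit.
Unset Printing Implicit Defensive.

Import Order.TTheory GRing.Theory Num.Theory.
Import numFieldNormedType.Exports.

Local Open Scope classical_set_scope.
Local Open Scope ring_scope.

(** The posterior is the measure with density [exp (- Phi u y) / Z y] with
    respect to [mu0], and everything rests on this density being measurable,
    everywhere positive and of integral one.

    Measurability: every point of [X] lies in some ball around the origin, on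
    which [Phi (.; y)] is Lipschitz, so [Phi (.; y)] is continuous, and the
    sigma-algebra contains the open sets ([lipschitz_balls_continuous],
    [continuous_borel_measurable]).  Finiteness of [Z y]: with [r > |y|], the
    lower bound on [Phi] exponentiates to
    [exp (- Phi u y) <= exp (- M r) * f1 |u|], which is integrable.
    Positivity of [Z y]: an everywhere positive function has zero integral
    only over a null set ([gt0_integral_eq0]), and [mu0 X = 1].

    The same positivity shows that the posterior and [mu0] have the same null
    sets.  Completeness only speaks of null sets, so it passes from one
    measure to the other ([complete_borel_equiv]).  So does the Radon property
    ([radon_dominated]): in a Borel set, some countable union of compact
    subsets has full [mu0]-measure, hence full posterior measure, and the
    posterior measures of the finite unions converge to it. *)

(** * Measures given by a density *)

Section probability_of_density.
Local Open Scope ereal_scope.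
Context d (T : measurableType d) (R : realType).
Variables (mu : {measure set T -> \bar R}) (f : T -> \bar R).

(** The properties of [f] are arguments of the set function so that the measure
    and probability structures below can be attached to it. *)
Definition density_measure (mf : measurable_fun setT f)
    (f_ge0 : forall x, 0 <= f x) (f_int1 : \int[mu]_x f x = 1) (A : set T) :=
  \int[mu]_(x in A) f x.

Hypotheses (mf : measurable_fun setT f) (f_ge0 : forall x, 0 <= f x).
Hypothesis f_int1 : \int[mu]_x f x = 1.

Local Notation nu := (density_measure mf f_ge0 f_int1).

Let nu0 : nu set0 = 0.
Proof. exact: integral_set0. Qed.

Let nu_ge0 A : 0 <= nu A.
Proof. by apply: integral_ge0 => x _. Qed.

Let nu_sigma_additive : semi_sigma_additive nu.
Proof. exact: semi_sigma_additive_nng_induced. Qed.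

HB.instance Definition _ :=
  isMeasure.Build _ _ _ nu nu0 nu_ge0 nu_sigma_additive.

HB.instance Definition _ := @Measure_isProbability.Build _ _ _ nu f_int1.

Lemma probability_of_density : exists P : probability T R,
  forall A : set T, P A = \int[mu]_(x in A) f x.
Proof. by exists nu. Qed.

End probability_of_density.

Section positive_density.
Local Open Scope ereal_scope.
Context d (T : measurableType d) (R : realType).
Variables (mu : {measure set T -> \bar R}) (f : T -> \bar R) (A : set T).
Hypotheses (mA : measurable A) (mf : measurable_fun A f).
Hypothesis f_gt0 : forall x, A x -> 0 < f x.

(** This is what makes a measure with positive density equivalent to the
    reference measure, and what keeps the normalizing constant away from 0. *)
Lemma gt0_integral_eq0 : \int[mu]_(x in A) f x = 0 <-> mu A = 0.
Proof.
split=> [fA0|A0]; last exact: null_set_integral.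
have : \int[mu]_(x in A) `|f x| = 0.
  rewrite -fA0; apply: eq_integral => x /[!inE] Ax.
  by rewrite gee0_abs// ltW// f_gt0.
move/ae_eq_integral_abs => /(_ mA mf) [N [mN N0 subN]].
apply: (subset_measure0 _ _ _ N0) => // x Ax.
by apply: subN => /= /(_ Ax) fx0; have := f_gt0 Ax; rewrite fx0 ltxx.
Qed.

End positive_density.

(** * Borel sets of a normed space *)

Section borel_sets.
Context (R : realType) (X : normedModType R) (G : set (set X)).
Hypothesis borelG : borel X `<=` <<s G >>.

Lemma continuous_borel_measurable (f : X -> R) : continuous f ->
  measurable_fun [set: g_sigma_algebraType G] f.
Proof.
move=> /continuousP cf; apply: (measurability _ (RGenOpens.measurableE R)).
move=> _ [_ [a [b ->] <-]]; rewrite setTI; apply: borelG.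
by apply: sub_sigma_algebra; apply: cf; exact: interval_open.
Qed.

Lemma borel_compact (K : set X) : compact K -> borel X K.
Proof.
move=> /(compact_closed (@norm_hausdorff _ X)) cK.
rewrite -(setCK K) -setTD; apply: sigma_algebraCD.
by apply: sub_sigma_algebra; exact: closed_openC.
Qed.

End borel_sets.

(** * Regularity properties under a change of measure *)

Section change_of_measure.
Local Open Scope ereal_scope.
Context (R : realType) (X : normedModType R) (G : set (set X)).
Variables mu nu : probability (g_sigma_algebraType G) R.
Hypothesis nu_mu : nu `<< mu.

(** The two dominations serve different clauses: a set that is null for [nu]
    must be null for [mu] in order to be measurable, whereas the Borel bounds
    of a measurable set, tight for [mu], must stay tight for [nu]. *)
Lemma complete_borel_equiv :
  mu `<< nu -> complete_borel mu -> complete_borel nu.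
Proof.
move=> /null_content_dominatesP mu_nu [borelG mu_complete mu_borel]; split=> //.
  move=> N [M [mM M0 NM]]; apply: mu_complete.
  by exists M; split=> //; exact: mu_nu.
move=> A /mu_borel[B [C [bB bC BA AC CB0]]]; exists B, C; split=> //.
move/null_content_dominatesP : nu_mu; apply => //.
by apply: measurableD; exact: borelG.
Qed.

(** Inner regularity of [mu] yields compact sets [K n] inside [B] such that
    [mu (K n)] tends to [mu B]; their union then exhausts [B] up to a set which
    is null for [mu], hence for [nu], and [nu] is continuous along the
    increasing finite unions [U n], which are compact. *)
Lemma radon_dominated : borel X `<=` <<s G >> -> radon mu -> radon nu.
Proof.
move=> borelG radon_mu B bB.
pose compacts := [set K : set X | compact K /\ K `<=` B].
have mcompact K : compact K -> measurable (K : set (g_sigma_algebraType G)).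
  by move=> cK; apply: borelG; exact: borel_compact.
have mB : measurable (B : set (g_sigma_algebraType G)) by exact: borelG.
apply/eqP; rewrite eq_le; apply/andP; split; last first.
  apply/ereal_supP => _ [K [cK KB] <-].
  by apply: le_measure; rewrite ?inE//; exact: mcompact.
have [|v mu_v v_mu] := @ereal_sup_seq _ [set mu K | K in compacts].
  apply/set0P; exists (mu set0); exists set0 => //; split => //.
  exact: compact0.
have {mu_v} /choice[K K_v] n : exists K, compacts K /\ mu K = v n.
  by have [K cK <-] := mu_v n; exists K.
have cK n : compact (K n) by case: (K_v n) => -[].
pose U n := \big[setU/set0]_(i < n) K i : set (g_sigma_algebraType G).
have cU n : compact (U n) by apply: bigsetU_compact => i _.
have UB n : U n `<=` B.
  rewrite /U; elim/big_ind : _ => // [C D CB DB|i _]; first by rewrite subUset.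
  by case: (K_v i) => -[].
have mU n : measurable (U n) by exact: mcompact.
have mcupU : measurable (\bigcup_n U n) by exact: bigcup_measurable.
have cupUB : \bigcup_n U n `<=` B by apply: bigcup_sub => n _; exact: UB.
(* [mu B] is the limit of the [mu (K n)], and each [K n] lies in [U n.+1]. *)
have muB : mu B <= mu (\bigcup_n U n).
  rewrite [leLHS]radon_mu//; apply: (cvge_to_le v_mu).
  apply: nearW => n; case: (K_v n) => _ <-.
  apply: le_measure; rewrite ?inE//; first exact: mcompact.
  by move=> x Kx; exists n.+1 => //; rewrite /U big_ord_recr/=; right.
have nuBU0 : nu (B `\` \bigcup_n U n) = 0.
  move/null_content_dominatesP : nu_mu; apply; first exact: measurableD.
  apply/eqP; rewrite eq_le measure_ge0 andbT measureD//; last first.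
    by rewrite (le_lt_trans (probability_le1 _ _))// ltry.
  by rewrite setIidr// sube_le0.
have -> : nu B = nu (\bigcup_n U n).
  rewrite -[in LHS](setDUK cupUB) measureU//; last 2 first.
  - exact: measurableD.
  - exact: setDIK.
  by rewrite [X in _ + X](_ : _ = 0)// adde0.
apply: (cvge_to_le (nondecreasing_cvg_mu mU mcupU _)).
  by move=> m n mn; apply/subsetPset; exact: subset_bigsetU.
by apply: nearW => n; apply: ereal_sup_ubound; exists (U n).
Qed.

End change_of_measure.

(** * Well-posedness of Bayes' rule *)

Section locally_lipschitz.
Context (R : realType) (X : normedModType R).

(** A Lipschitz constant is available near [u] because the ball of radius
    [|u| + 1] around the origin is a neighbourhood of [u]. *)
Lemma lipschitz_balls_continuous (f : X -> R) :
  (forall r, 0 < r -> exists L : R, forall u v, ball (0 : X) r u ->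
    ball (0 : X) r v -> `|f u - f v| <= L * `|u - v|) ->
  continuous f.
Proof.
move=> lipf u.
have [|L lipL] := lipf (`|u| + 1); first exact: ltr_wpDl.
have u_ball : ball (0 : X) (`|u| + 1) u.
  by rewrite -ball_normE/= sub0r normrN ltrDl.
(* [L] may vanish or be negative, hence the constant [|L| + 1]. *)
have K_gt0 : 0 < `|L| + 1 by exact: ltr_wpDl.
apply/cvgrPdist_lt => e e_gt0.
near=> v.
have v_ball : ball (0 : X) (`|u| + 1) v.
  near: v; apply: open_nbhs_nbhs; split => //; exact: ball_open.
have uv : `|u - v| < e / (`|L| + 1).
  by near: v; apply: cvgr_dist_lt; rewrite ?divr_gt0.
rewrite (le_lt_trans (lipL _ _ u_ball v_ball))//.
move: uv; rewrite ltr_pdivlMr//; apply: le_lt_trans.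
by rewrite mulrC ler_wpM2l// (le_trans (ler_norm L))// lerDl.
Unshelve. all: by end_near. Qed.

End locally_lipschitz.

Theorem theorem4p2 (R : realType) (X Y : completeNormedModType R)
    (G : set (set X)) (mu0 : probability (g_sigma_algebraType G) R)
    (Hmu0 : complete_borel mu0)
    (Phi : X -> Y -> R) (f1 : R -> R)
    (f1_ge1 : forall t : R, 0 <= t -> 1 <= f1 t)
    (f1_ndecr : forall s t : R, 0 <= s -> s <= t -> f1 s <= f1 t)
    (Hi : forall r : R, 0 < r -> exists M : R,
      forall (u : X) (y : Y), ball (0 : Y) r y ->
        M - ln (f1 `|u|) <= Phi u y)
    (Hii : forall r : R, 0 < r -> exists2 K : R, 0 < K &
      forall (u : X) (y : Y), ball (0 : X) r u -> ball (0 : Y) r y ->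
        Phi u y <= K)
    (Hiii : forall r : R, 0 < r -> exists2 L : R, 0 < L &
      forall (u1 u2 : X) (y : Y),
        ball (0 : X) r u1 -> ball (0 : X) r u2 -> ball (0 : Y) r y ->
        `|Phi u1 y - Phi u2 y| <= L * `|u1 - u2|)
    (Hf1 : mu0.-integrable [set: g_sigma_algebraType G]
      (fun u : X => (f1 `|u|)%:E)) :
  forall y : Y,
    bayes_well_defined mu0 Phi y /\
    exists mu : probability (g_sigma_algebraType G) R,
      [/\ is_posterior mu0 Phi y mu,
          complete_borel mu &
          radon mu0 -> radon mu].
Proof.
move=> y; case: (Hmu0) => borelG _ _.
have y_r : ball (0 : Y) (`|y| + 1) y.
  by rewrite -ball_normE/= sub0r normrN ltrDl.
have cPhi : continuous (Phi^~ y).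
  apply: lipschitz_balls_continuous => r r_gt0.
  (* The radius must be large enough for all of [u], [v] and [y]. *)
  have s_gt0 : 0 < Num.max r (`|y| + 1) by rewrite lt_max r_gt0.
  have [L _ LP] := Hiii _ s_gt0; exists L => u v ur vr.
  by apply: LP; [move: ur|move: vr|move: y_r];
     apply: le_ball; rewrite le_max lexx ?orbT.
have mlik : measurable_fun setT (likelihood (G := G) Phi y).
  apply/measurable_EFinP; apply: measurableT_comp => //.
  apply: measurable_funN.
  exact: continuous_borel_measurable.
have Zgt0 : (0 < evidence mu0 Phi y)%E.
  rewrite lt0e integral_ge0 ?andbT; last first.
    by move=> u _; rewrite lee_fin expR_ge0.
  apply/eqP => /(gt0_integral_eq0 mu0 measurableT mlik) mu0T.
  have /eqP : mu0 setT = 0%E by apply: mu0T => u _; rewrite lte_fin expR_gt0.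
  by rewrite probability_setT onee_eq0.
have Zlty : (evidence mu0 Phi y < +oo)%E.
  have [M MP] := Hi (`|y| + 1) (ltr_wpDl (normr_ge0 _) ltr01).
  apply: integrable_lty => //.
  apply: (le_integrable measurableT mlik _
    (integrableZl measurableT (expR (- M)) Hf1)).
  move=> u _ /=; rewrite lee_fin.
  have f1_gt0 : 0 < f1 `|u| by rewrite (lt_le_trans ltr01)// f1_ge1.
  rewrite !ger0_norm ?mulr_ge0 ?expR_ge0 ?(ltW f1_gt0)//.
  rewrite -[X in _ * X](lnK f1_gt0) -expRD ler_expR lerNl.
  by rewrite opprD opprK MP.
split; first by split=> //; rewrite Zgt0.
pose Z := fine (evidence mu0 Phi y).
have ZE : evidence mu0 Phi y = Z%:E by rewrite fineK// gt0_fin_numE.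
have Z_gt0 : 0 < Z by rewrite -lte_fin -ZE.
pose density (u : g_sigma_algebraType G) := (expR (- Phi u y) / Z)%:E.
have density_gt0 u : (0 < density u)%E.
  by rewrite lte_fin divr_gt0// expR_gt0.
have densityE : density = (fun u => (Z^-1)%:E * likelihood Phi y u)%E.
  by apply/funext => u; rewrite /density mulrC EFinM.
have mdensity : measurable_fun setT density.
  by rewrite densityE; exact: measurable_funeM.
have density_int1 : (\int[mu0]_u density u = 1)%E.
  rewrite densityE ge0_integralZl_EFin//; last 2 first.
  - by move=> u _; rewrite lee_fin expR_ge0.
  - by rewrite invr_ge0 ltW.
  by rewrite -/(evidence mu0 Phi y) ZE -EFinM mulVf// gt_eqF.
have [mu muE] :=
  probability_of_density mdensity (fun u => ltW (density_gt0 u)) density_int1.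
have mu_eq0 (A : set (g_sigma_algebraType G)) : measurable A ->
    mu A = 0%E <-> mu0 A = 0%E.
  move=> mA; rewrite muE; apply: gt0_integral_eq0 => //.
  exact: measurable_funTS.
have mu_mu0 : mu `<< mu0.
  by apply/null_content_dominatesP => A mA /mu_eq0; exact.
have mu0_mu : mu0 `<< mu.
  by apply/null_content_dominatesP => A mA /mu_eq0; exact.
exists mu; split.
- by move=> A _; exact: muE.
- exact: complete_borel_equiv Hmu0.
- exact: radon_dominated.
Qed.
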